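(* Let $l,\rho,c,\gamma,q_0,h_0,D_\infty>0$ and $0<\epsilon<1$ be given, and consider the thermal conductivity $k>0$ as an unknown of the free boundary problem (P) described in the context. Then the solution of (P), including the unknown coefficient $k$, is given by, with $\alpha=\frac{k}{\rho c}$, $$T(x,t)=\frac{q_0\sqrt{\pi\alpha}}{k}\left[\operatorname{erf}\left(\frac{x}{2\sqrt{\alpha t}}\right)-\operatorname{erf}(\xi)\right]\quad (0<x<s(t),\ t>0),$$ $$s(t)=2\xi\sqrt{\alpha t},\qquad r(t)=2\left[\xi+\frac{\gamma k}{2q_0\sqrt{\alpha}}\exp(\xi^2)\right]\sqrt{\alpha t}\quad (t>0),$$ with $k>0$ given by $$k=\frac{\pi}{\rho c}\left[\frac{q_0\operatorname{erf}(\xi)}{D_\infty\left(1-\frac{q_0}{h_0D_\infty}\right)}\right]^2$$ and $\xi>0$ the unique solution of the equation $$f_4(x)=\frac{cD_\infty}{l\sqrt\pi}\left(1-\frac{q_0}{h_0D_\infty}\right),\quad x>0,$$ where $$f_4(x)=\left[x+\frac{\gamma\sqrt\pi(1-\epsilon)}{2D_\infty\left(1-\frac{q_0}{h_0D_\infty}\right)}\operatorname{erf}(x)\exp(x^2)\right]\operatorname{erf}(x)\exp(x^2),\quad x>0,$$ if and only if $$1-\frac{q_0}{h_0D_\infty}>0.$$ (That is: there exist $k>0$ and $\xi>0$ such that the triple $(T,s,r)$ with $T(x,t)=\frac{q_0\sqrt{\pi\alpha}}{k}\left[\operatorname{erf}\left(\frac{x}{2\sqrt{\alpha t}}\right)-\operatorname{erf}(\xi)\right]$,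 $s(t)=2\xi\sqrt{\alpha t}$ and $r(t)=2\left[\xi+\frac{\gamma k}{2q_0\sqrt{\alpha}}\exp(\xi^2)\right]\sqrt{\alpha t}$ solves (P) if and only if this inequality holds, and in that case the equation $f_4(x)=\frac{cD_\infty}{l\sqrt\pi}\left(1-\frac{q_0}{h_0D_\infty}\right)$ has a unique positive solution, $\xi$ is this solution, and $k=\frac{\pi}{\rho c}\left[\frac{q_0\operatorname{erf}(\xi)}{D_\infty\left(1-\frac{q_0}{h_0D_\infty}\right)}\right]^2$.)
   Context: Problem (P): find $T=T(x,t)$ and free boundaries $x=s(t)$, $x=r(t)$ such that $$\rho c\,T_t(x,t)-kT_{xx}(x,t)=0,\quad 0<x<s(t),\ t>0;$$ $$T(s(t),t)=0,\quad t>0;$$ $$kT_x(s(t),t)=\rho l\,[\epsilon\dot s(t)+(1-\epsilon)\dot r(t)],\quad t>0;$$ $$T_x(s(t),t)\,(r(t)-s(t))=\gamma,\quad t>0;$$ $$r(0)=s(0)=0;$$ $$kT_x(0,t)=\frac{q_0}{\sqrt t},\quad t>0;$$ $$kT_x(0,t)=\frac{h_0}{\sqrt t}\,(T(0,t)+D_\infty),\quad t>0.$$ All parameters $l,k,\rho,c,\gamma,q_0,h_0,D_\infty$ are positive real constants and $0<\epsilon<1$. Here $T$ and $T_x$ at $x=0$ and $x=s(t)$ are the boundary values from $0<x<s(t)$. The error function is $\operatorname{erf}(x)=\frac{2}{\sqrt\pi}\int_0^x e^{-u^2}\,du$. *)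

(* Defs.v *)
From Stdlib Require Import Reals.
From Coquelicot Require Import Coquelicot.
Open Scope R_scope.

Definition erf (x : R) : R := 2 / sqrt PI * RInt (fun u => exp (- u ^ 2)) 0 x.

Definition D_x (T : R -> R -> R) (x t : R) : R := Derive (fun y => T y t) x.
Definition D_xx (T : R -> R -> R) (x t : R) : R := Derive (fun y => D_x T y t) x.
Definition D_t (T : R -> R -> R) (x t : R) : R := Derive (fun u => T x u) t.

(** [T] is total, but only its values on [0 < x < s t], [t > 0] matter.
    [Derive] is total too, so the existence of every derivative used is required
    separately.  The boundary values at [x = 0] and [x = s t] are the one-sided
    limits [T0], [Tx0], [Txs] (and [0] for [T] at [x = s t]). *)
Record solves_P (k rho c l eps gamma q0 h0 Dinf : R)
    (T : R -> R -> R) (s r : R -> R) : Prop := {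
  domain_nonempty : forall t, 0 < t -> 0 < s t;
  boundaries_derivable : forall t, 0 < t -> ex_derive s t /\ ex_derive r t;
  initial_s : s 0 = 0 /\ filterlim s (at_right 0) (locally 0);
  initial_r : r 0 = 0 /\ filterlim r (at_right 0) (locally 0);
  T_derivable : forall x t, 0 < t -> 0 < x < s t ->
    ex_derive (fun u => T x u) t /\
    ex_derive (fun y => T y t) x /\
    ex_derive (fun y => D_x T y t) x;
  heat_equation : forall x t, 0 < t -> 0 < x < s t ->
    rho * c * D_t T x t - k * D_xx T x t = 0;
  boundary_conditions : forall t, 0 < t ->
    exists T0 Tx0 Txs : R,
      filterlim (fun x => T x t) (at_right 0) (locally T0) /\
      filterlim (fun x => D_x T x t) (at_right 0) (locally Tx0) /\
      filterlim (fun x => T x t) (at_left (s t)) (locally 0) /\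
      filterlim (fun x => D_x T x t) (at_left (s t)) (locally Txs) /\
      k * Txs = rho * l * (eps * Derive s t + (1 - eps) * Derive r t) /\
      Txs * (r t - s t) = gamma /\
      k * Tx0 = q0 / sqrt t /\
      k * Tx0 = h0 / sqrt t * (T0 + Dinf)
}.

Definition T_sim (k rho c q0 xi x t : R) : R :=
  let alpha := k / (rho * c) in
  q0 * sqrt (PI * alpha) / k * (erf (x / (2 * sqrt (alpha * t))) - erf xi).

Definition s_sim (k rho c xi t : R) : R :=
  let alpha := k / (rho * c) in
  2 * xi * sqrt (alpha * t).

Definition r_sim (k rho c gamma q0 xi t : R) : R :=
  let alpha := k / (rho * c) in
  2 * (xi + gamma * k / (2 * q0 * sqrt alpha) * exp (xi ^ 2)) * sqrt (alpha * t).

Definition f4 (gamma eps q0 h0 Dinf x : R) : R :=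
  (x + gamma * sqrt PI * (1 - eps) / (2 * Dinf * (1 - q0 / (h0 * Dinf)))
       * erf x * exp (x ^ 2))
  * erf x * exp (x ^ 2).

(* Main.v *)
(** In the similarity variable [x / (2 a sqrt t)], with [a = sqrt alpha], the
    heat equation and all conditions but two hold identically.  The convective
    condition at [x = 0] and the Stefan condition at [x = s t] are proportional
    to [1 / sqrt t] and reduce to two equations in [(a, xi)].  The first one has
    a solution [a > 0] only if [1 - q0 / (h0 Dinf) > 0]; eliminating [a] from the
    second one gives the equation for [f4], which increases from [0] to infinity. *)
From Stdlib Require Import Reals Lra.
From Coquelicot Require Import Coquelicot.
Require Import Defs.
Open Scope R_scope.

(** * The error function: derivative, monotonicity, sign *)

Lemma is_derive_erf (x : R) : is_derive erf x (2 / sqrt PI * exp (- x ^ 2)).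
Proof.
  assert (Hc : forall y, continuous (fun u => exp (- u ^ 2)) y).
  { intros y. apply (ex_derive_continuous (fun u => exp (- u ^ 2))). auto_derive. exact I. }
  unfold erf. apply is_derive_scal. apply (is_derive_RInt (fun u => exp (- u ^ 2)) _ 0); [|apply Hc].
  (* The radius 1 is arbitrary: the integrand is continuous everywhere, hence integrable between any
     two points. *)
  exists (mkposreal 1 Rlt_0_1); intros y _. apply (@RInt_correct R_CompleteNormedModule).
  apply ex_RInt_continuous. intros z _. apply Hc.
Qed.

Lemma sqrt_PI_gt_0 : 0 < sqrt PI.
Proof. apply sqrt_lt_R0, PI_RGT_0. Qed.

Lemma erf_increasing (x y : R) : x < y -> erf x < erf y.
Proof.
  intros Hxy.
  apply (incr_function erf m_infty p_infty (fun z => 2 / sqrt PI * exp (- z ^ 2))); try easy.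
  - intros z _ _. apply is_derive_erf.
  - intros z _ _. apply Rmult_lt_0_compat; [|apply exp_pos].
    apply Rdiv_lt_0_compat; [lra|apply sqrt_PI_gt_0].
Qed.

Lemma erf_0 : erf 0 = 0.
Proof.
  unfold erf. rewrite RInt_point. apply Rmult_0_r.
Qed.

Lemma erf_pos (x : R) : 0 < x -> 0 < erf x.
Proof. intros Hx. rewrite <- erf_0. now apply erf_increasing. Qed.

(** * One-sided limits of continuous functions *)

Lemma continuous_at_right (f : R -> R) (x : R) :
  continuous f x -> filterlim f (at_right x) (locally (f x)).
Proof. intros H. eapply filterlim_filter_le_1; [apply filter_le_within|exact H]. Qed.

Lemma continuous_at_left (f : R -> R) (x : R) :
  continuous f x -> filterlim f (at_left x) (locally (f x)).
Proof. intros H. eapply filterlim_filter_le_1; [apply filter_le_within|exact H]. Qed.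

(** * The similarity profile: closed forms and derivatives *)

Section Similarity.

Variables k rho c q0 gamma : R.
Hypotheses (hk : 0 < k) (hrho : 0 < rho) (hc : 0 < c) (hq0 : 0 < q0).
Let a := sqrt (k / (rho * c)).

Lemma diffusivity_root_pos : 0 < a.
Proof. apply sqrt_lt_R0, Rdiv_lt_0_compat; [easy|now apply Rmult_lt_0_compat]. Qed.

(** Eliminates [k] in favour of [a], so that expressions mixing [k] with the square root of the
    diffusivity become rational in [a] and accessible to [field]. *)
Lemma conductivity_eq : k = rho * c * a ^ 2.
Proof.
  unfold a. rewrite pow2_sqrt; [field; lra|].
  apply Rlt_le, Rdiv_lt_0_compat; [easy|now apply Rmult_lt_0_compat].
Qed.

Lemma sqrt_diffusivity_mult (t : R) : sqrt (k / (rho * c) * t) = a * sqrt t.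
Proof.
  apply sqrt_mult_alt, Rlt_le, Rdiv_lt_0_compat; [easy|now apply Rmult_lt_0_compat].
Qed.

Lemma T_sim_eq (xi x t : R) :
  T_sim k rho c q0 xi x t
  = q0 * sqrt PI / (rho * c * a) * (erf (x / (2 * (a * sqrt t))) - erf xi).
Proof.
  pose proof diffusivity_root_pos as Ha.
  unfold T_sim. cbv zeta. rewrite sqrt_diffusivity_mult.
  rewrite sqrt_mult_alt by apply Rlt_le, PI_RGT_0. fold a.
  f_equal. rewrite conductivity_eq. field. lra.
Qed.

Lemma s_sim_eq (xi t : R) : s_sim k rho c xi t = 2 * xi * a * sqrt t.
Proof. unfold s_sim. cbv zeta. rewrite sqrt_diffusivity_mult. ring. Qed.

Lemma r_sim_eq (xi t : R) :
  r_sim k rho c gamma q0 xi t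
  = (2 * xi * a + gamma * rho * c * a ^ 2 / q0 * exp (xi ^ 2)) * sqrt t.
Proof.
  pose proof diffusivity_root_pos as Ha.
  unfold r_sim. cbv zeta. rewrite sqrt_diffusivity_mult. fold a.
  rewrite conductivity_eq at 1. field. lra.
Qed.

Lemma is_derive_scal_sqrt (b t : R) :
  0 < t -> is_derive (fun u => b * sqrt u) t (b / (2 * sqrt t)).
Proof.
  intros Ht. pose proof (sqrt_lt_R0 t Ht). auto_derive; [easy|field; lra].
Qed.

Lemma is_derive_s_sim (xi t : R) :
  0 < t -> is_derive (s_sim k rho c xi) t (xi * a / sqrt t).
Proof.
  intros Ht. pose proof (sqrt_lt_R0 t Ht).
  eapply is_derive_ext; [intros u; symmetry; apply s_sim_eq|].
  replace (xi * a / sqrt t) with (2 * xi * a / (2 * sqrt t)) by (field; lra).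
  now apply is_derive_scal_sqrt.
Qed.

Lemma is_derive_r_sim (xi t : R) :
  0 < t -> is_derive (r_sim k rho c gamma q0 xi) t
    ((xi * a + gamma * rho * c * a ^ 2 / (2 * q0) * exp (xi ^ 2)) / sqrt t).
Proof.
  intros Ht. pose proof (sqrt_lt_R0 t Ht).
  eapply is_derive_ext; [intros u; symmetry; apply r_sim_eq|].
  replace (_ / sqrt t) with
    ((2 * xi * a + gamma * rho * c * a ^ 2 / q0 * exp (xi ^ 2)) / (2 * sqrt t))
    by (field; lra).
  now apply is_derive_scal_sqrt.
Qed.

(** Chain rule. The factor [2 / sqrt PI] in the derivative of [erf] cancels the [sqrt PI] in the
    amplitude, which is what makes the flux at [x = 0] equal to [q0 / sqrt t]. *)
Lemma is_derive_T_sim_x (xi x t : R) :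
  0 < t -> is_derive (fun y => T_sim k rho c q0 xi y t) x
    (q0 / (k * sqrt t) * exp (- (x / (2 * (a * sqrt t))) ^ 2)).
Proof.
  intros Ht. pose proof (sqrt_lt_R0 t Ht) as Hst. pose proof diffusivity_root_pos as Ha.
  pose proof sqrt_PI_gt_0 as Hpi.
  eapply is_derive_ext; [intros y; symmetry; apply T_sim_eq|].
  (* The derivative is put in the shape produced by the differentiation rules; the [- 0] comes from
     the constant [erf xi]. *)
  replace (_ * exp _) with (q0 * sqrt PI / (rho * c * a) *
    (/ (2 * (a * sqrt t)) * (2 / sqrt PI * exp (- (x / (2 * (a * sqrt t))) ^ 2)) - 0)).
  2:{ rewrite conductivity_eq at 1. field. lra. }
  apply is_derive_scal, @is_derive_minus; [|apply @is_derive_const].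
  apply (is_derive_comp erf (fun y => y / (2 * (a * sqrt t)))); [apply is_derive_erf|].
  auto_derive; [easy|field; lra].
Qed.

Lemma D_x_T_sim (xi x t : R) :
  0 < t -> D_x (T_sim k rho c q0 xi) x t
    = q0 / (k * sqrt t) * exp (- (x / (2 * (a * sqrt t))) ^ 2).
Proof. intros Ht. now apply is_derive_unique, is_derive_T_sim_x. Qed.

Lemma is_derive_D_x_T_sim (xi x t : R) :
  0 < t -> is_derive (fun y => D_x (T_sim k rho c q0 xi) y t) x
    (- q0 * x / (2 * a ^ 2 * k * t * sqrt t) * exp (- (x / (2 * (a * sqrt t))) ^ 2)).
Proof.
  intros Ht. pose proof (sqrt_lt_R0 t Ht) as Hst. pose proof diffusivity_root_pos as Ha.
  eapply is_derive_ext; [intros y; symmetry; now apply D_x_T_sim|].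
  auto_derive; [easy|].
  set (e := exp (- (x / (2 * (a * sqrt t))) ^ 2)). change (exp _) with e.
  (* [field] treats [sqrt t] as an atom unrelated to [t], so [t] is written as its square. *)
  replace (2 * a ^ 2 * k * t * sqrt t) with (2 * a ^ 2 * k * (sqrt t * sqrt t) * sqrt t)
    by (rewrite sqrt_sqrt; lra).
  field. lra.
Qed.

(** The value is [a ^ 2] times the second space derivative found above; since [k = rho * c * a ^ 2],
    the heat equation follows for every [xi]. *)
Lemma is_derive_T_sim_t (xi x t : R) :
  0 < t -> is_derive (fun u => T_sim k rho c q0 xi x u) t
    (- q0 * x / (2 * k * t * sqrt t) * exp (- (x / (2 * (a * sqrt t))) ^ 2)).
Proof.
  intros Ht. pose proof (sqrt_lt_R0 t Ht) as Hst. pose proof diffusivity_root_pos as Ha.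
  pose proof sqrt_PI_gt_0 as Hpi.
  eapply is_derive_ext; [intros u; symmetry; apply T_sim_eq|].
  replace (_ * exp _) with (q0 * sqrt PI / (rho * c * a) *
    (- x / (4 * a * t * sqrt t) * (2 / sqrt PI * exp (- (x / (2 * (a * sqrt t))) ^ 2)) - 0)).
  2:{ rewrite conductivity_eq at 1. field. lra. }
  apply is_derive_scal, @is_derive_minus; [|apply @is_derive_const].
  apply (is_derive_comp erf (fun u => x / (2 * (a * sqrt u)))); [apply is_derive_erf|].
  auto_derive; [split; [easy|split; [|easy]]; nra|].
  replace (4 * a * t * sqrt t) with (4 * a * (sqrt t * sqrt t) * sqrt t)
    by (rewrite sqrt_sqrt; lra).
  field. lra.
Qed.

(** * Initial and boundary values; reduction of (P) to two equations in [a] and [xi] *)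

Variables l eps h0 Dinf : R.
Hypothesis hh0 : 0 < h0.

Lemma scal_sqrt_initial (b : R) :
  b * sqrt 0 = 0 /\ filterlim (fun t => b * sqrt t) (at_right 0) (locally 0).
Proof.
  assert (H : b * sqrt 0 = 0) by (rewrite sqrt_0; ring).
  split; [exact H|]. rewrite <- H at 2.
  apply (continuous_at_right (fun t => b * sqrt t)).
  (* Two-sided continuity holds even at 0, because the total [sqrt] vanishes on negative numbers. *)
  apply (continuous_mult (fun _ => b) sqrt); [apply continuous_const|apply continuous_sqrt].
Qed.

(** The closed form extends smoothly across both boundaries, so the one-sided limits required by (P)
    are plain values. *)
Lemma continuous_D_x_T_sim (xi x t : R) :
  0 < t -> continuous (fun y => D_x (T_sim k rho c q0 xi) y t) x.
Proof.
  intros Ht. apply (ex_derive_continuous (fun y => D_x (T_sim k rho c q0 xi) y t)).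
  eexists. now apply is_derive_D_x_T_sim.
Qed.

Lemma continuous_T_sim (xi x t : R) :
  0 < t -> continuous (fun y => T_sim k rho c q0 xi y t) x.
Proof.
  intros Ht. apply (ex_derive_continuous (fun y => T_sim k rho c q0 xi y t)).
  eexists. now apply is_derive_T_sim_x.
Qed.

Lemma T_sim_0 (xi t : R) :
  T_sim k rho c q0 xi 0 t = - (q0 * sqrt PI / (rho * c * a) * erf xi).
Proof.
  rewrite T_sim_eq. unfold Rdiv at 2. rewrite Rmult_0_l, erf_0. ring.
Qed.

Lemma D_x_T_sim_0 (xi t : R) :
  0 < t -> D_x (T_sim k rho c q0 xi) 0 t = q0 / (k * sqrt t).
Proof.
  intros Ht. rewrite D_x_T_sim by easy. unfold Rdiv at 2.
  replace (- (0 * / (2 * (a * sqrt t))) ^ 2) with 0 by ring. rewrite exp_0. ring.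
Qed.

Lemma similarity_s_sim (xi t : R) :
  0 < t -> s_sim k rho c xi t / (2 * (a * sqrt t)) = xi.
Proof.
  intros Ht. pose proof (sqrt_lt_R0 t Ht). pose proof diffusivity_root_pos.
  rewrite s_sim_eq. field. lra.
Qed.

Lemma T_sim_s (xi t : R) :
  0 < t -> T_sim k rho c q0 xi (s_sim k rho c xi t) t = 0.
Proof.
  intros Ht. rewrite T_sim_eq, similarity_s_sim by easy. ring.
Qed.

Lemma D_x_T_sim_s (xi t : R) :
  0 < t -> D_x (T_sim k rho c q0 xi) (s_sim k rho c xi t) t
           = q0 / (k * sqrt t) * / exp (xi ^ 2).
Proof.
  intros Ht. now rewrite D_x_T_sim, similarity_s_sim, exp_Ropp by easy.
Qed.

(** Both sides are constants divided by [sqrt t]; multiplying by [sqrt t * exp (xi ^ 2)] removes the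
    time, and the two [xi * a] contributions merge because their weights [eps] and [1 - eps] add up
    to 1. *)
Lemma stefan_condition_sim (xi t : R) :
  0 < t ->
  k * D_x (T_sim k rho c q0 xi) (s_sim k rho c xi t) t
    = rho * l * (eps * Derive (s_sim k rho c xi) t
                 + (1 - eps) * Derive (r_sim k rho c gamma q0 xi) t)
  <-> q0 = rho * l * a * exp (xi ^ 2)
             * (xi + (1 - eps) * gamma * rho * c * a / (2 * q0) * exp (xi ^ 2)).
Proof.
  intros Ht. pose proof (sqrt_lt_R0 t Ht) as Hst. pose proof (exp_pos (xi ^ 2)) as HE.
  rewrite D_x_T_sim_s by easy.
  rewrite (is_derive_unique _ _ _ (is_derive_s_sim xi t Ht)).
  rewrite (is_derive_unique _ _ _ (is_derive_r_sim xi t Ht)).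
  assert (Hw : 0 < sqrt t * exp (xi ^ 2)) by (now apply Rmult_lt_0_compat).
  split; intros H.
  - apply (Rmult_eq_compat_r (sqrt t * exp (xi ^ 2))) in H.
    field_simplify in H; [|lra|lra]. field_simplify; [|lra]. lra.
  - apply (Rmult_eq_reg_r (sqrt t * exp (xi ^ 2))); [|lra].
    field_simplify in H; [|lra]. field_simplify; [|lra|lra]. lra.
Qed.

(** The flux [q0 / sqrt t] is [h0 / sqrt t] times [q0 / h0], so the common factor cancels; the
    temperature at [x = 0] does not depend on [t]. *)
Lemma convective_condition_sim (xi t : R) :
  0 < t ->
  k * D_x (T_sim k rho c q0 xi) 0 t
    = h0 / sqrt t * (T_sim k rho c q0 xi 0 t + Dinf)
  <-> q0 * sqrt PI / (rho * c * a) * erf xi = Dinf - q0 / h0.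
Proof.
  intros Ht. pose proof (sqrt_lt_R0 t Ht) as Hst.
  rewrite D_x_T_sim_0, T_sim_0 by easy.
  set (Z := _ * erf xi).
  replace (k * (q0 / (k * sqrt t))) with (h0 / sqrt t * (q0 / h0)) by (field; lra).
  assert (0 < h0 / sqrt t) by (now apply Rdiv_lt_0_compat).
  split; intros H0; [apply Rmult_eq_reg_l in H0; lra|f_equal; lra].
Qed.

Lemma solves_P_sim_iff (xi : R) :
  0 < xi ->
  solves_P k rho c l eps gamma q0 h0 Dinf
    (T_sim k rho c q0 xi) (s_sim k rho c xi) (r_sim k rho c gamma q0 xi)
  <-> q0 * sqrt PI / (rho * c * a) * erf xi = Dinf - q0 / h0
      /\ q0 = rho * l * a * exp (xi ^ 2)
                * (xi + (1 - eps) * gamma * rho * c * a / (2 * q0) * exp (xi ^ 2)).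
Proof.
  intros Hxi. pose proof diffusivity_root_pos as Ha. split.
  (* The reduced equations are free of [t], so evaluating at the single time 1 suffices. Uniqueness
     of limits then identifies the boundary values supplied by [H] with values of the closed
     forms. *)
  - intros H. destruct (boundary_conditions _ _ _ _ _ _ _ _ _ _ _ _ H 1 Rlt_0_1)
      as (T0 & Tx0 & Txs & L0 & Lx0 & _ & Lxs & HS & _ & _ & HC).
    assert (T0 = T_sim k rho c q0 xi 0 1) as ->.
    { apply (filterlim_locally_unique _ _ _ L0).
      apply (continuous_at_right (fun x => T_sim k rho c q0 xi x 1)).
      apply continuous_T_sim, Rlt_0_1. }
    assert (Tx0 = D_x (T_sim k rho c q0 xi) 0 1) as ->.
    { apply (filterlim_locally_unique _ _ _ Lx0).
      apply (continuous_at_right (fun x => D_x (T_sim k rho c q0 xi) x 1)).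
      apply continuous_D_x_T_sim, Rlt_0_1. }
    assert (Txs = D_x (T_sim k rho c q0 xi) (s_sim k rho c xi 1) 1) as ->.
    { apply (filterlim_locally_unique _ _ _ Lxs).
      apply (continuous_at_left (fun x => D_x (T_sim k rho c q0 xi) x 1)).
      apply continuous_D_x_T_sim, Rlt_0_1. }
    split.
    + exact (proj1 (convective_condition_sim xi 1 Rlt_0_1) HC).
    + exact (proj1 (stefan_condition_sim xi 1 Rlt_0_1) HS).
  - intros [HC HS]. constructor.
    + intros t Ht. rewrite s_sim_eq. pose proof (sqrt_lt_R0 t Ht).
      repeat apply Rmult_lt_0_compat; lra.
    + intros t Ht. split; eexists; [now apply is_derive_s_sim|now apply is_derive_r_sim].
    + rewrite s_sim_eq. destruct (scal_sqrt_initial (2 * xi * a)) as [H1 H2].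
      split; [exact H1|]. eapply filterlim_ext; [|exact H2].
      intros t. symmetry. apply s_sim_eq.
    + rewrite r_sim_eq.
      destruct (scal_sqrt_initial (2 * xi * a + gamma * rho * c * a ^ 2 / q0 * exp (xi ^ 2)))
        as [H1 H2].
      split; [exact H1|]. eapply filterlim_ext; [|exact H2].
      intros t. symmetry. apply r_sim_eq.
    + intros x t Ht _. repeat split; eexists;
        [now apply is_derive_T_sim_t|now apply is_derive_T_sim_x|now apply is_derive_D_x_T_sim].
    + intros x t Ht _. pose proof (sqrt_lt_R0 t Ht).
      pose proof (is_derive_unique _ _ _ (is_derive_T_sim_t xi x t Ht) : D_t _ x t = _) as ->.
      pose proof (is_derive_unique _ _ _ (is_derive_D_x_T_sim xi x t Ht) : D_xx _ x t = _) as ->.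
      rewrite conductivity_eq. field. lra.
    + intros t Ht. pose proof (sqrt_lt_R0 t Ht) as Hst. pose proof (exp_pos (xi ^ 2)) as HE.
      exists (T_sim k rho c q0 xi 0 t), (D_x (T_sim k rho c q0 xi) 0 t),
        (D_x (T_sim k rho c q0 xi) (s_sim k rho c xi t) t).
      split; [|split; [|split; [|split; [|split; [|split; [|split]]]]]].
      * apply (continuous_at_right (fun x => T_sim k rho c q0 xi x t)).
        now apply continuous_T_sim.
      * apply (continuous_at_right (fun x => D_x (T_sim k rho c q0 xi) x t)).
        now apply continuous_D_x_T_sim.
      * rewrite <- (T_sim_s xi t Ht).
        apply (continuous_at_left (fun x => T_sim k rho c q0 xi x t)).
        now apply continuous_T_sim.
      * apply (continuous_at_left (fun x => D_x (T_sim k rho c q0 xi) x t)).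
        now apply continuous_D_x_T_sim.
      * now apply stefan_condition_sim.
      (* The width [r t - s t] equals [gamma * k / q0 * exp (xi ^ 2) * sqrt t], which is [gamma]
         divided by the gradient at [s t]. *)
      * rewrite D_x_T_sim_s, r_sim_eq, s_sim_eq by easy.
        rewrite conductivity_eq at 1. field. lra.
      * rewrite D_x_T_sim_0 by easy. field. lra.
      * now apply convective_condition_sim.
Qed.

(** The convective equation is solved for [a], which amounts to the formula for [k]; inserting this
    [a] into the Stefan equation leaves the equation for [f4]. *)
Lemma similarity_equations_iff (xi : R) :
  0 < l -> 0 < xi -> 0 < Dinf -> 1 - q0 / (h0 * Dinf) > 0 ->
  (q0 * sqrt PI / (rho * c * a) * erf xi = Dinf - q0 / h0
   /\ q0 = rho * l * a * exp (xi ^ 2)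
                * (xi + (1 - eps) * gamma * rho * c * a / (2 * q0) * exp (xi ^ 2)))
  <-> f4 gamma eps q0 h0 Dinf xi
        = c * Dinf / (l * sqrt PI) * (1 - q0 / (h0 * Dinf))
      /\ k = PI / (rho * c) * (q0 * erf xi / (Dinf * (1 - q0 / (h0 * Dinf)))) ^ 2.
Proof.
  intros Hl Hxi HD HM. unfold f4.
  pose proof diffusivity_root_pos as Ha. pose proof sqrt_PI_gt_0 as Hpi.
  pose proof (exp_pos (xi ^ 2)) as HE. pose proof (erf_pos xi Hxi) as He.
  set (M := 1 - q0 / (h0 * Dinf)) in *. set (E := exp (xi ^ 2)) in *. set (e := erf xi) in *.
  replace (Dinf - q0 / h0) with (Dinf * M) by (unfold M; field; lra).
  clearbody M E e.
  (* The formula for [k] is [rho * c] times the square of the formula for [a]; both roots are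
     positive, so the squares can be removed. *)
  assert (Hk : k = PI / (rho * c) * (q0 * e / (Dinf * M)) ^ 2
               <-> a = q0 * sqrt PI * e / (rho * c * (Dinf * M))).
  { replace (PI / (rho * c)) with (sqrt PI ^ 2 / (rho * c))
      by now rewrite pow2_sqrt by apply Rlt_le, PI_RGT_0.
    assert (Hb : 0 < q0 * sqrt PI * e / (rho * c * (Dinf * M)))
      by (apply Rdiv_lt_0_compat; repeat apply Rmult_lt_0_compat; lra).
    replace (sqrt PI ^ 2 / (rho * c) * _) with
      (rho * c * (q0 * sqrt PI * e / (rho * c * (Dinf * M))) ^ 2) by (field; lra).
    rewrite conductivity_eq. set (b := _ / (rho * c * (Dinf * M))) in *.
    split; [|now intros ->]. intros H. apply Rmult_eq_reg_l in H; [apply Rsqr_inj; unfold Rsqr; lra|].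
    apply Rgt_not_eq. now apply Rmult_lt_0_compat. }
  rewrite Hk.
  assert (H1 : q0 * sqrt PI / (rho * c * a) * e = Dinf * M
               <-> a = q0 * sqrt PI * e / (rho * c * (Dinf * M))).
  { split; intros H; [rewrite <- H|rewrite H]; field; repeat split; lra. }
  rewrite H1.
  assert (H2 : a = q0 * sqrt PI * e / (rho * c * (Dinf * M)) ->
    (q0 = rho * l * a * E * (xi + (1 - eps) * gamma * rho * c * a / (2 * q0) * E)
     <-> (xi + gamma * sqrt PI * (1 - eps) / (2 * Dinf * M) * e * E) * e * E
         = c * Dinf / (l * sqrt PI) * M)).
  { intros ->.
    (* After substitution the Stefan equation reads [q0 = q0 * L * F], where [F] is the value of
       [f4] and [L] is the reciprocal of the prescribed right-hand side. *)
    replace (rho * l * _ * E * _) with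
      (q0 * (l * sqrt PI / (c * (Dinf * M)))
       * ((xi + gamma * sqrt PI * (1 - eps) / (2 * Dinf * M) * e * E) * e * E))
      by (field; lra).
    set (F := _ * e * E).
    split; intros H.
    - apply (Rmult_eq_reg_l (q0 * (l * sqrt PI / (c * (Dinf * M))))).
      + rewrite <- H. field. lra.
      + apply Rgt_not_eq. apply Rmult_lt_0_compat; [easy|].
        apply Rdiv_lt_0_compat; repeat apply Rmult_lt_0_compat; lra.
    - rewrite H. field. lra. }
  tauto.
Qed.

End Similarity.

(** * The function [f4]: a bijection of the positive half-line *)

Section F4.

Variables gamma eps q0 h0 Dinf : R.
Hypotheses (hgamma : 0 < gamma) (heps : 0 < eps < 1) (hD : 0 < Dinf)
  (hM : 1 - q0 / (h0 * Dinf) > 0).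

Let K := gamma * sqrt PI * (1 - eps) / (2 * Dinf * (1 - q0 / (h0 * Dinf))).

Lemma f4_coefficient_pos : 0 < K.
Proof.
  pose proof sqrt_PI_gt_0.
  apply Rdiv_lt_0_compat; repeat apply Rmult_lt_0_compat; lra.
Qed.

Lemma continuity_f4 : continuity (f4 gamma eps q0 h0 Dinf).
Proof.
  intros x. apply continuity_pt_filterlim.
  apply (ex_derive_continuous (f4 gamma eps q0 h0 Dinf)). unfold f4. fold K.
  auto_derive. pose proof (is_derive_erf x). repeat split; eexists; eassumption.
Qed.

Lemma exp_sqr_increasing (x y : R) : 0 <= x -> x < y -> exp (x ^ 2) < exp (y ^ 2).
Proof. intros Hx Hxy. apply exp_increasing. nra. Qed.

(** With [g x = erf x * exp (x ^ 2)], which is positive and increasing for positive [x], [f4] is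
    [(x + K * g x) * g x]: a product of two positive increasing factors. *)
Lemma f4_increasing (x y : R) :
  0 < x -> x < y -> f4 gamma eps q0 h0 Dinf x < f4 gamma eps q0 h0 Dinf y.
Proof.
  intros Hx Hxy. pose proof f4_coefficient_pos as HK. unfold f4. fold K.
  pose proof (erf_pos x Hx). pose proof (erf_increasing x y Hxy).
  pose proof (exp_pos (x ^ 2)).
  pose proof (exp_sqr_increasing x y (Rlt_le _ _ Hx) Hxy).
  assert (Hg : 0 < erf x * exp (x ^ 2) < erf y * exp (y ^ 2)).
  { split; [now apply Rmult_lt_0_compat|apply Rmult_le_0_lt_compat; lra]. }
  rewrite !Rmult_assoc.
  set (u := erf x * _) in *. set (v := erf y * _) in *.
  apply Rmult_le_0_lt_compat; nra.
Qed.

(** Intermediate value theorem between 0, where [f4] vanishes, and a point where it is at least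
    [B]. *)
Lemma f4_surjective (B : R) :
  0 < B -> exists xi, 0 < xi /\ f4 gamma eps q0 h0 Dinf xi = B.
Proof.
  intros HB. pose proof f4_coefficient_pos as HK.
  assert (F0 : f4 gamma eps q0 h0 Dinf 0 = 0) by (unfold f4; rewrite erf_0; ring).
  pose proof (erf_pos 1 Rlt_0_1) as He1.
  assert (HBe : 0 < B / erf 1) by (now apply Rdiv_lt_0_compat).
  (* [N > 1] gives [erf N * exp (N ^ 2) > erf 1], and [N] exceeds [B / erf 1]; the product of these
     two bounds is [B]. *)
  set (N := 1 + B / erf 1).
  assert (FN : B <= f4 gamma eps q0 h0 Dinf N).
  { unfold f4. fold K.
    assert (erf 1 < erf N) by (apply erf_increasing; unfold N; lra).
    assert (1 < exp (N ^ 2)).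
    { rewrite <- exp_0. apply exp_increasing. unfold N. nra. }
    assert (B = B / erf 1 * erf 1) by (field; lra).
    assert (Hg : erf 1 < erf N * exp (N ^ 2)) by nra.
    rewrite !Rmult_assoc. set (g := erf N * _) in *.
    assert (B / erf 1 <= N + K * g) by (unfold N; nra). nra. }
  destruct (IVT_gen (f4 gamma eps q0 h0 Dinf) 0 N B continuity_f4) as [xi [Hxi Hf]].
  { rewrite F0, Rmin_left, Rmax_right by lra. lra. }
  rewrite Rmin_left in Hxi by (unfold N; lra).
  exists xi. split; [|easy].
  (* The endpoint [xi = 0] is excluded, since [f4] is 0 there and [B] is positive. *)
  destruct (proj1 Hxi) as [|<-]; [easy|lra].
Qed.

Lemma f4_injective (x y : R) :
  0 < x -> 0 < y -> f4 gamma eps q0 h0 Dinf x = f4 gamma eps q0 h0 Dinf y -> x = y.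
Proof.
  intros Hx Hy H. destruct (Rtotal_order x y) as [L|[E|L]]; [|easy|].
  - pose proof (f4_increasing x y Hx L). lra.
  - pose proof (f4_increasing y x Hy L). lra.
Qed.

End F4.

(** * Solvability criterion and determination of [k] and [xi] *)

Theorem theorem3p4 (l rho c gamma q0 h0 Dinf eps : R)
    (hl : 0 < l) (hrho : 0 < rho) (hc : 0 < c) (hgamma : 0 < gamma)
    (hq0 : 0 < q0) (hh0 : 0 < h0) (hDinf : 0 < Dinf) (heps : 0 < eps < 1) :
  ((exists k xi : R, 0 < k /\ 0 < xi /\
      solves_P k rho c l eps gamma q0 h0 Dinf
        (T_sim k rho c q0 xi) (s_sim k rho c xi) (r_sim k rho c gamma q0 xi))
   <-> 1 - q0 / (h0 * Dinf) > 0)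
  /\
  (1 - q0 / (h0 * Dinf) > 0 ->
     (exists! xi : R, 0 < xi /\
        f4 gamma eps q0 h0 Dinf xi
        = c * Dinf / (l * sqrt PI) * (1 - q0 / (h0 * Dinf)))
     /\
     (forall k xi : R, 0 < k -> 0 < xi ->
        (solves_P k rho c l eps gamma q0 h0 Dinf
           (T_sim k rho c q0 xi) (s_sim k rho c xi) (r_sim k rho c gamma q0 xi)
         <->
         f4 gamma eps q0 h0 Dinf xi
         = c * Dinf / (l * sqrt PI) * (1 - q0 / (h0 * Dinf))
         /\ k = PI / (rho * c)
                * (q0 * erf xi / (Dinf * (1 - q0 / (h0 * Dinf)))) ^ 2))).
Proof.
  assert (Hiff : 1 - q0 / (h0 * Dinf) > 0 -> forall k xi : R, 0 < k -> 0 < xi ->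
        (solves_P k rho c l eps gamma q0 h0 Dinf
           (T_sim k rho c q0 xi) (s_sim k rho c xi) (r_sim k rho c gamma q0 xi)
         <->
         f4 gamma eps q0 h0 Dinf xi
         = c * Dinf / (l * sqrt PI) * (1 - q0 / (h0 * Dinf))
         /\ k = PI / (rho * c)
                * (q0 * erf xi / (Dinf * (1 - q0 / (h0 * Dinf)))) ^ 2)).
  { intros HM k xi Hk Hxi. rewrite solves_P_sim_iff by easy.
    now apply similarity_equations_iff. }
  pose proof sqrt_PI_gt_0 as Hpi.
  assert (Hex : 1 - q0 / (h0 * Dinf) > 0 -> exists xi, 0 < xi /\
            f4 gamma eps q0 h0 Dinf xi
            = c * Dinf / (l * sqrt PI) * (1 - q0 / (h0 * Dinf))).
  { intros HM. apply f4_surjective; try easy.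
    apply Rmult_lt_0_compat; [|easy].
    apply Rdiv_lt_0_compat; now apply Rmult_lt_0_compat. }
  split; [split|].
  (* Necessity: the convective equation equates [Dinf - q0 / h0] with a product of positive numbers;
     dividing by [Dinf] gives the inequality. *)
  - intros (k & xi & Hk & Hxi & HP).
    apply solves_P_sim_iff in HP; try easy. destruct HP as [HC _].
    pose proof (diffusivity_root_pos k rho c Hk hrho hc) as Ha.
    pose proof (erf_pos xi Hxi) as He.
    assert (HZ : 0 < Dinf - q0 / h0).
    { rewrite <- HC. apply Rmult_lt_0_compat; [|easy].
      apply Rdiv_lt_0_compat; repeat apply Rmult_lt_0_compat; easy. }
    replace (1 - q0 / (h0 * Dinf)) with ((Dinf - q0 / h0) / Dinf) by (field; lra).
    now apply Rdiv_lt_0_compat.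
  (* Sufficiency: [xi] comes from surjectivity of [f4], and [k] is then defined by its formula, so
     [Hiff] applies once [k] is known to be positive. *)
  - intros HM. destruct (Hex HM) as (xi & Hxi & Hf).
    pose proof (erf_pos xi Hxi) as He.
    exists (PI / (rho * c) * (q0 * erf xi / (Dinf * (1 - q0 / (h0 * Dinf)))) ^ 2), xi.
    assert (Hk : 0 < PI / (rho * c) * (q0 * erf xi / (Dinf * (1 - q0 / (h0 * Dinf)))) ^ 2).
    { apply Rmult_lt_0_compat.
      - apply Rdiv_lt_0_compat; [apply PI_RGT_0|now apply Rmult_lt_0_compat].
      - apply pow_lt. apply Rdiv_lt_0_compat; now apply Rmult_lt_0_compat. }
    split; [easy|split; [easy|]]. now apply Hiff.
  - intros HM. split; [|now apply Hiff].
    destruct (Hex HM) as (xi & Hxi & Hf). exists xi. split; [easy|].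
    intros y [Hy Hfy].
    apply (f4_injective gamma eps q0 h0 Dinf); try easy. now rewrite Hf, Hfy.
Qed.
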